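(* Let $\mathcal{H}$ be an $n$-dimensional complex Hilbert space, $\mathcal{O}=\mathrm{Herm}(\mathcal{H})$, let $H\in\mathcal{O}$ be an observable, let $V_1,\dots,V_{n^2-1}\in\mathrm{End}(\mathcal{H})$, and let $K(\xi)=\sum_{j=1}^{n^2-1}V_j\xi V_j^*$ be the associated Kraus operator on $\mathcal{O}^*\cong\mathrm{Herm}(\mathcal{H})$. The vector field $Z_L$ on the set of states $\mathcal{D}$ defined as $$Z_L=\widetilde{X}_H-\widetilde{Y}_V+Z_K,\qquad V=\sum_{j=1}^{n^2-1}V_j^*V_j,$$ is linear and such that the system of differential equations for its integral curves is given by the Kossakowski-Lindblad equation $$\frac{d\rho}{dt}=L(\rho),\qquad L(\rho)=-i[H,\rho]-\frac12\sum_{j=1}^{n^2-1}[V_j^*V_j,\rho]_++\sum_{j=1}^{n^2-1}V_j\rho V_j^*.$$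
   Context: $\mathcal{O}=\mathrm{Herm}(\mathcal{H})$ carries the products $[[a,b]]=-\frac{i}{2}(ab-ba)$ and $a\odot b=\frac12(ab+ba)$; $[a,b]=ab-ba$ and $[a,b]_+=ab+ba$. $\mathcal{O}^*$ is identified with $\mathrm{Herm}(\mathcal{H})$ via the trace, $\xi(a)=\mathrm{tr}(\xi a)$. The set of states $\mathcal{D}$ is the set of density operators (positive, unit trace). The expectation value functions are $e_a(\rho)=\mathrm{tr}(\rho a)$, $a\in\mathcal{O}$. Differential calculus on $\mathcal{D}$ is inherited from its embedding in $\mathcal{O}^*$, and the vector fields below are described by their action on the functions $e_a$: - Hamiltonian vector field: $\widetilde{X}_b(e_a)=e_{[[b,a]]}$. - Gradient vector field: $\widetilde{Y}_b(e_a)=e_{b\odot a}-e_be_a$. - For an $\mathbb{R}$-linear map $T:\mathcal{O}^*\to\mathcal{O}^*$ with dual map $T^\sharp:\mathcal{O}\to\mathcal{O}$ ($T(\xi)(a)=\xi(T^\sharp(a))$): $Z_T(e_a)=e_{T^\sharp(a)}-e_{T^\sharp(I)}e_a$. ''Linear'' refers to the absence of the quadratic terms $e_b e_a$: $Z_L(e_a)=e_{[[H,a]]}-e_{V\odot a}+e_{K^\sharp(a)}$ is again an expectation value function for every $a\in\mathcal{O}$.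
   Formalization: With [[a,b]] = -(i/2)(ab-ba) the Hamiltonian field is (i/2)[H,ρ], so the displayed L(ρ) with -i[H,ρ] is false in general; the equation for the integral curves is proved with H replaced by -H/2 in L, the other terms unchanged. *)

(* Defs.v *)
From HB Require Import structures.
From mathcomp Require Import all_boot all_order all_algebra.
From mathcomp Require Export complex.
From mathcomp Require Import all_classical all_reals all_analysis.

Set Implicit Arguments.
Unset Strict Implicit.
Unset Printing Implicit Defensive.

Import Order.TTheory GRing.Theory Num.Theory numFieldNormedType.Exports.

Local Open Scope classical_set_scope.
Local Open Scope ring_scope.

(* The n-dimensional Hilbert space is C^n with its standard inner product, so
   that End(H) is 'M[R[i]]_n and the adjoint is the conjugate transpose. *)
Definition adj (R : realType) (m n : nat) (A : 'M[R[i]]_(m, n)) :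
    'M[R[i]]_(n, m) :=
  map_mx Num.conj A^T.

Definition herm (R : realType) (n : nat) (A : 'M[R[i]]_n) : Prop := adj A = A.

Definition comm (R : realType) (n : nat) (a b : 'M[R[i]]_n) : 'M[R[i]]_n :=
  a *m b - b *m a.

Definition acomm (R : realType) (n : nat) (a b : 'M[R[i]]_n) : 'M[R[i]]_n :=
  a *m b + b *m a.

Definition lie (R : realType) (n : nat) (a b : 'M[R[i]]_n) : 'M[R[i]]_n :=
  (- ('i / 2%:R)) *: comm a b.

Definition jordan (R : realType) (n : nat) (a b : 'M[R[i]]_n) : 'M[R[i]]_n :=
  2%:R^-1 *: acomm a b.

(* [0 <= z] in R[i] says that z is real and nonnegative. *)
Definition state (R : realType) (n : nat) (rho : 'M[R[i]]_n) : Prop :=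
  [/\ herm rho,
      forall v : 'cV[R[i]]_n, 0 <= (adj v *m rho *m v) 0 0
    & \tr rho = 1].

(* tr (xi a) is real when xi and a are Hermitian; Re only casts it into R.
   This is also the identification of a Hermitian xi with an element of the
   dual of the observables. *)
Definition expect (R : realType) (n : nat) (a xi : 'M[R[i]]_n) : R :=
  complex.Re (\tr (xi *m a)).

(* Derivative at rho, along the tangent vector xi, of a function on the dual of
   the observables. *)
Definition dirder (R : realType) (n : nat) (f : 'M[R[i]]_n -> R)
    (rho xi : 'M[R[i]]_n) : R :=
  derive1 (fun s : R => f (rho + (s%:C)%C *: xi)) 0.

(* Fields are total functions on matrices, but only their values at states
   matter.  The states have nonempty interior in the affine space of Hermitian
   matrices of trace 1, whence the tangent vectors. *)
Definition tangent (R : realType) (n : nat) (xi : 'M[R[i]]_n) : Prop :=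
  herm xi /\ \tr xi = 0.

Definition vector_field (R : realType) (n : nat)
    (Z : 'M[R[i]]_n -> 'M[R[i]]_n) : Prop :=
  forall rho, state rho -> tangent (Z rho).

Definition act (R : realType) (n : nat) (Z : 'M[R[i]]_n -> 'M[R[i]]_n)
    (f : 'M[R[i]]_n -> R) (rho : 'M[R[i]]_n) : R :=
  dirder f rho (Z rho).

(* The vector field Z determined by Z(e_a) = phi a for every observable a: a
   tangent vector is determined by its action on the e_a.  The value is 0 at
   rho if no tangent vector acts in the prescribed way. *)
Definition field_of (R : realType) (n : nat)
    (phi : 'M[R[i]]_n -> 'M[R[i]]_n -> R) (rho : 'M[R[i]]_n) : 'M[R[i]]_n :=
  xget 0 [set xi | tangent xi /\
                   forall a, herm a -> dirder (expect a) rho xi = phi a rho].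

Definition hamiltonian_field (R : realType) (n : nat) (b : 'M[R[i]]_n) :
    'M[R[i]]_n -> 'M[R[i]]_n :=
  field_of (fun a rho => expect (lie b a) rho).

Definition gradient_field (R : realType) (n : nat) (b : 'M[R[i]]_n) :
    'M[R[i]]_n -> 'M[R[i]]_n :=
  field_of (fun a rho => expect (jordan b a) rho - expect b rho * expect a rho).

(* The dual map of a real-linear T, as an operator on observables. *)
Definition dual_map (R : realType) (n : nat) (T : 'M[R[i]]_n -> 'M[R[i]]_n)
    (a : 'M[R[i]]_n) : 'M[R[i]]_n :=
  xget 0 [set b | herm b /\
                  forall xi, herm xi -> expect a (T xi) = expect b xi].

Definition map_field (R : realType) (n : nat) (T : 'M[R[i]]_n -> 'M[R[i]]_n) :
    'M[R[i]]_n -> 'M[R[i]]_n :=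
  field_of (fun a rho => expect (dual_map T a) rho -
                         expect (dual_map T 1%:M) rho * expect a rho).

Definition kraus (R : realType) (n m : nat) (V : 'I_m -> 'M[R[i]]_n)
    (xi : 'M[R[i]]_n) : 'M[R[i]]_n :=
  \sum_(j < m) V j *m xi *m adj (V j).

Definition kraus_obs (R : realType) (n m : nat) (V : 'I_m -> 'M[R[i]]_n) :
    'M[R[i]]_n :=
  \sum_(j < m) adj (V j) *m V j.

Definition ZL (R : realType) (n m : nat) (H : 'M[R[i]]_n)
    (V : 'I_m -> 'M[R[i]]_n) (rho : 'M[R[i]]_n) : 'M[R[i]]_n :=
  hamiltonian_field H rho - gradient_field (kraus_obs V) rho
  + map_field (kraus V) rho.

Definition linear_field (R : realType) (n : nat)
    (Z : 'M[R[i]]_n -> 'M[R[i]]_n) : Prop :=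
  forall a, herm a ->
    exists2 c, herm c & forall rho, state rho ->
                          act Z (expect a) rho = expect c rho.

(* Evaluating the definition of the Hamiltonian field with the bracket
   [lie b a] = -(i/2)(ba - ab) gives (i/2)[H, rho]; this is the term
   -i[h, rho] below for h = -H/2. *)
Definition lindblad (R : realType) (n m : nat) (h : 'M[R[i]]_n)
    (V : 'I_m -> 'M[R[i]]_n) (rho : 'M[R[i]]_n) : 'M[R[i]]_n :=
  (- 'i) *: comm h rho
  - 2%:R^-1 *: (\sum_(j < m) acomm (adj (V j) *m V j) rho)
  + \sum_(j < m) V j *m rho *m adj (V j).

(* Derivative at t of a real function on the interval I, one-sided at an
   endpoint of I that belongs to I. *)
Definition has_der (R : realType) (I : interval R) (f : R -> R) (t l : R) :
    Prop :=
  (s - t)^-1 * (f s - f t) @[s --> within [set` I] t^'] --> l.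

Definition mx_has_der (R : realType) (n : nat) (I : interval R)
    (rho : R -> 'M[R[i]]_n) (t : R) (A : 'M[R[i]]_n) : Prop :=
  forall j k,
    has_der I (fun s => complex.Re (rho s j k)) t (complex.Re (A j k)) /\
    has_der I (fun s => complex.Im (rho s j k)) t (complex.Im (A j k)).

Definition solution (R : realType) (n : nat) (F : 'M[R[i]]_n -> 'M[R[i]]_n)
    (I : interval R) (rho : R -> 'M[R[i]]_n) : Prop :=
  forall t, t \in I -> mx_has_der I rho t (F (rho t)).

Definition integral_curve (R : realType) (n : nat)
    (Z : 'M[R[i]]_n -> 'M[R[i]]_n) (I : interval R) (rho : R -> 'M[R[i]]_n) :
    Prop :=
  (forall t, t \in I -> state (rho t)) /\ solution Z I rho.

(* Main.v *)
(* A Hermitian matrix is determined by its pairings with all Hermitian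
   matrices, so the fields defined by their action on the functions [expect a]
   can be computed by moving each operation across the trace.  At a state rho
   this gives (i/2)[H, rho], V o rho - e_V(rho) rho and
   K(rho) - e_{K#(1)}(rho) rho.  Since K#(1) = V, the quadratic terms cancel in
   the sum. *)
Require Import Defs.
From mathcomp Require Import all_boot all_order all_algebra.
From mathcomp Require Import all_classical all_reals all_analysis.

Local Open Scope ring_scope.

Import GRing.Theory Num.Theory numFieldNormedType.Exports.

(** * Adjoints and Hermitian matrices *)

Section Adjoint.
Variable R : realType.

Lemma adjB m n (A B : 'M[R[i]]_(m, n)) : adj (A - B) = adj A - adj B.
Proof. by apply/matrixP => j k; rewrite !mxE rmorphB. Qed.

Lemma adjD m n (A B : 'M[R[i]]_(m, n)) : adj (A + B) = adj A + adj B.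
Proof. by apply/matrixP => j k; rewrite !mxE rmorphD. Qed.

Lemma adjZ m n c (A : 'M[R[i]]_(m, n)) : adj (c *: A) = Num.conj c *: adj A.
Proof. by apply/matrixP => j k; rewrite !mxE rmorphM. Qed.

Lemma adjK m n (A : 'M[R[i]]_(m, n)) : adj (adj A) = A.
Proof. by apply/matrixP => j k; rewrite !mxE conjCK. Qed.

Lemma adjM m n p (A : 'M[R[i]]_(m, n)) (B : 'M[R[i]]_(n, p)) :
  adj (A *m B) = adj B *m adj A.
Proof. by rewrite /adj trmx_mul map_mxM. Qed.

Lemma adj_sum m n (I : Type) (r : seq I) (F : I -> 'M[R[i]]_(m, n)) :
  adj (\sum_(j <- r) F j) = \sum_(j <- r) adj (F j).
Proof.
elim/big_rec2: _ => [|j A B _ <-]; last by rewrite adjD.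
by apply/matrixP => j k; rewrite !mxE rmorph0.
Qed.

Lemma mxtrace_adj n (A : 'M[R[i]]_n) : \tr (adj A) = Num.conj (\tr A).
Proof. by rewrite /mxtrace rmorph_sum; apply: eq_bigr => j _; rewrite !mxE. Qed.

Lemma conjC_half : Num.conj (2%:R^-1 : R[i]) = 2%:R^-1.
Proof. by rewrite fmorphV rmorph_nat. Qed.

Lemma conjC_ihalf : Num.conj ('i / 2%:R : R[i]) = - ('i / 2%:R).
Proof.
by rewrite -mulNr -[in RHS]conjCi -[in RHS]conjC_half; exact: rmorphM.
Qed.

(** Lets the cast [complex.Re] in [expect] be undone for a trace that is its own conjugate. *)
Lemma Re_conj_fixed (z : R[i]) :
  Num.conj z = z -> ((complex.Re z)%:C)%C = z.
Proof.
by move/CrealP/Creal_ImP; case: z => x y; rewrite -complexIm => -[/= ->].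
Qed.

Lemma ReZ (x : R) (z : R[i]) :
  complex.Re ((x%:C)%C * z) = x * complex.Re z.
Proof. by case: z => a b /=; rewrite mul0r subr0. Qed.

Variable n : nat.
Implicit Types a b xi rho : 'M[R[i]]_n.

(** A commutator of Hermitian matrices is anti-Hermitian; conjugating the imaginary scalar supplies
    the compensating sign. *)
Lemma herm_comm_scaled a b : herm a -> herm b ->
  herm (('i / 2%:R) *: comm a b).
Proof.
move=> ha hb; rewrite /herm /comm adjZ adjB !adjM ha hb conjC_ihalf.
by rewrite scaleNr -scalerN opprB.
Qed.

Lemma lieE a b : lie a b = - (('i / 2%:R) *: comm a b).
Proof. by rewrite /lie scaleNr. Qed.

Lemma herm_lie a b : herm a -> herm b -> herm (lie a b).
Proof.
move=> ha hb; rewrite lieE /herm -scaleN1r adjZ rmorphN1.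
by rewrite (herm_comm_scaled _ _ ha hb).
Qed.

Lemma herm_jordan a b : herm a -> herm b -> herm (jordan a b).
Proof.
move=> ha hb; rewrite /herm /jordan /acomm adjZ adjD !adjM ha hb conjC_half.
by rewrite addrC.
Qed.

Lemma hermB a b : herm a -> herm b -> herm (a - b).
Proof. by move=> ha hb; rewrite /herm adjB ha hb. Qed.

Lemma hermD a b : herm a -> herm b -> herm (a + b).
Proof. by move=> ha hb; rewrite /herm adjD ha hb. Qed.

Lemma hermZ (x : R) a : herm a -> herm ((x%:C)%C *: a).
Proof.
move=> ha; rewrite /herm adjZ ha; congr (_ *: _).
by apply/eqP; rewrite eq_complex /= oppr0 !eqxx.
Qed.

Lemma herm_kraus_obs m (V : 'I_m -> 'M[R[i]]_n) : herm (kraus_obs V).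
Proof.
by rewrite /herm /kraus_obs adj_sum; apply: eq_bigr => j _; rewrite adjM adjK.
Qed.

Lemma herm_kraus m (V : 'I_m -> 'M[R[i]]_n) xi : herm xi -> herm (kraus V xi).
Proof.
move=> hxi; rewrite /herm /kraus adj_sum; apply: eq_bigr => j _.
by rewrite !adjM adjK hxi mulmxA.
Qed.

End Adjoint.

(** * The trace pairing and the fields determined by it *)

Section Expectation.
Variables (R : realType) (n : nat).
Implicit Types a b c xi rho : 'M[R[i]]_n.

Lemma expectDr a xi rho : expect a (xi + rho) = expect a xi + expect a rho.
Proof. by rewrite /expect mulmxDl mxtraceD raddfD. Qed.

Lemma expectBr a xi rho : expect a (xi - rho) = expect a xi - expect a rho.
Proof. by rewrite /expect mulmxBl raddfB raddfB. Qed.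

Lemma expectZr a (x : R) xi : expect a ((x%:C)%C *: xi) = x * expect a xi.
Proof. by rewrite /expect -scalemxAl mxtraceZ ReZ. Qed.

Lemma expectC a b : expect a b = expect b a.
Proof. by rewrite /expect mxtrace_mulC. Qed.

Lemma mxtrace_mul_herm a b : herm a -> herm b ->
  \tr (a *m b) = ((expect b a)%:C)%C.
Proof.
move=> ha hb; rewrite /expect Re_conj_fixed //.
by rewrite -mxtrace_adj adjM ha hb mxtrace_mulC.
Qed.

(** Positive definiteness of the trace form: on a Hermitian matrix it is the squared Frobenius
    norm. *)
Lemma expect_herm_self xi : herm xi -> expect xi xi = 0 -> xi = 0.
Proof.
move=> hxi h.
have: \tr (xi *m xi) = 0 by rewrite mxtrace_mul_herm // h.
have -> : \tr (xi *m xi) = \sum_j \sum_k `|xi j k| ^+ 2.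
  apply: eq_bigr => j _; rewrite mxE; apply: eq_bigr => k _.
  (* Hermiticity turns the entry at (k, j) into the conjugate of the entry at (j, k). *)
  by rewrite normCK -[in X in _ * X = _]hxi !mxE.
move/eqP; rewrite psumr_eq0; last first.
  by move=> j _; apply: sumr_ge0 => k _; rewrite exprn_ge0.
move=> /allP h0; apply/matrixP => j k; rewrite mxE.
have := h0 j (mem_index_enum _); rewrite psumr_eq0; last first.
  by move=> l _; rewrite exprn_ge0.
by move=> /allP/(_ k (mem_index_enum _)); rewrite /= expf_eq0 normr_eq0 => /eqP.
Qed.

(** Test against [c = a - b], itself Hermitian. *)
Lemma expect_inj a b : herm a -> herm b ->
  (forall c, herm c -> expect c a = expect c b) -> a = b.
Proof.
move=> ha hb h; apply/eqP; rewrite -subr_eq0; apply/eqP/expect_herm_self.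
  exact: hermB.
by rewrite expectBr h ?subrr //; exact: hermB.
Qed.

Lemma dirder_expect a rho xi : dirder (expect a) rho xi = expect a xi.
Proof.
rewrite /dirder derive1E.
(* By real linearity, [expect a] is affine along the line through [rho], with slope
   [expect a xi]. *)
rewrite (_ : (fun s : R => _) = cst (expect a rho) + (expect a xi) \*o id).
  by rewrite derive_val add0r [LHS]mulr1.
by apply/funext => s /=; rewrite expectDr expectZr mulrC.
Qed.

(** Replaces the choice in [field_of] by an explicit vector: [expect_inj] leaves at most one
    candidate. *)
Lemma field_of_eq (phi : 'M[R[i]]_n -> 'M[R[i]]_n -> R) rho xi :
  tangent xi -> (forall a, herm a -> expect a xi = phi a rho) ->
  field_of phi rho = xi.
Proof.
move=> txi hxi; apply: xget_subset1.
  by split => // a ha; rewrite dirder_expect hxi.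
move=> u v [[hu _] eu] [[hv _] ev]; apply: expect_inj => // c hc.
by rewrite -!(dirder_expect _ rho) eu // ev.
Qed.

(** By cyclicity, tr(rho [b, a]) = tr([rho, b] a) = - tr([b, rho] a), so the factor -i/2 becomes
    i/2. *)
Lemma expect_lie a b rho :
  expect (lie b a) rho = expect a (('i / 2%:R) *: comm b rho).
Proof.
rewrite /expect /lie /comm scaleNr mulmxN -scalemxAr -scalemxAl.
rewrite -scalerN mxtraceZ mxtraceZ mulmxBr mulmxBl opprB !raddfB /=.
by rewrite !mulmxA (mxtrace_mulC _ b) !mulmxA.
Qed.

Lemma expect_jordan a b rho : expect (jordan b a) rho = expect a (jordan b rho).
Proof.
rewrite /expect /jordan /acomm -scalemxAr -scalemxAl !mxtraceZ.
rewrite mulmxDr mulmxDl !mxtraceD.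
by rewrite !mulmxA (mxtrace_mulC _ b) !mulmxA addrC.
Qed.

Lemma mxtrace_comm a b : \tr (comm a b) = 0.
Proof. by rewrite /comm raddfB /= mxtrace_mulC subrr. Qed.

Lemma mxtrace_jordan a b : \tr (jordan a b) = \tr (a *m b).
Proof.
rewrite /jordan /acomm mxtraceZ mxtraceD [\tr (b *m a)]mxtrace_mulC -mulr2n.
by rewrite -(mulr_natl (\tr _) 2) mulKf // pnatr_eq0.
Qed.

(** * Dual maps and Kraus operators *)

Lemma dual_mapE (T : 'M[R[i]]_n -> 'M[R[i]]_n) a b : herm b ->
  (forall xi, herm xi -> expect a (T xi) = expect b xi) -> dual_map T a = b.
Proof.
move=> hb h; apply: xget_subset1; first by split.
move=> u v [hu eu] [hv ev]; apply: expect_inj => // c hc.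
by rewrite expectC -eu // ev // expectC.
Qed.

Variables (m : nat) (V : 'I_m -> 'M[R[i]]_n).

(** Cyclicity carries each [V j] to the other end: tr(V xi V* a) = tr(xi V* a V). *)
Lemma dual_map_kraus a : herm a -> dual_map (kraus V) a = kraus (fun j => adj (V j)) a.
Proof.
move=> ha; apply: dual_mapE => [|xi hxi]; first exact: herm_kraus.
rewrite /expect /kraus; congr complex.Re.
rewrite mulmx_suml mulmx_sumr !raddf_sum; apply: eq_bigr => j _ /=.
by rewrite adjK -!mulmxA mxtrace_mulC !mulmxA.
Qed.

Lemma herm1 : herm (1%:M : 'M[R[i]]_n).
Proof. by rewrite /herm /adj trmx1 map_mx1. Qed.

Lemma dual_map_kraus1 : dual_map (kraus V) 1%:M = kraus_obs V.
Proof.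
rewrite dual_map_kraus; last exact: herm1.
by apply: eq_bigr => j _; rewrite /= adjK mulmx1.
Qed.

Lemma expect_dual_map_kraus a rho : herm a -> herm rho ->
  expect (dual_map (kraus V) a) rho = expect a (kraus V rho).
Proof.
move=> ha hrho; rewrite dual_map_kraus // /expect /kraus; congr complex.Re.
rewrite mulmx_suml mulmx_sumr !raddf_sum; apply: eq_bigr => j _ /=.
by rewrite adjK -!mulmxA [RHS]mxtrace_mulC !mulmxA.
Qed.

(** This trace is also that of [jordan (kraus_obs V) rho], which makes the difference of the two
    terms traceless. *)
Lemma mxtrace_kraus rho : \tr (kraus V rho) = \tr (kraus_obs V *m rho).
Proof.
rewrite /kraus /kraus_obs mulmx_suml !raddf_sum; apply: eq_bigr => j _ /=.
by rewrite mxtrace_mulC mulmxA.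
Qed.

(** * Explicit form of the fields at a state *)

Lemma hamiltonian_fieldE b rho : herm b -> herm rho ->
  hamiltonian_field b rho = ('i / 2%:R) *: comm b rho.
Proof.
move=> hb hrho; apply: field_of_eq => [|a ha]; last by rewrite expect_lie.
by split; [exact: herm_comm_scaled | rewrite mxtraceZ mxtrace_comm mulr0].
Qed.

(** Since [rho] has trace 1, the multiple of [rho] subtracts exactly the trace of the Jordan
    product, giving a tangent vector. *)
Lemma gradient_fieldE b rho : herm b -> state rho ->
  gradient_field b rho = jordan b rho - ((expect b rho)%:C)%C *: rho.
Proof.
move=> hb [hrho _ tr1]; apply: field_of_eq => [|a ha]; last first.
  by rewrite expectBr expectZr expect_jordan.
split; first by apply: hermB; [exact: herm_jordan | exact: hermZ].
rewrite raddfB /= mxtrace_jordan mxtraceZ tr1 mulr1 mxtrace_mul_herm //.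
by rewrite expectC subrr.
Qed.

Lemma map_field_krausE rho : state rho ->
  map_field (kraus V) rho =
  kraus V rho - ((expect (kraus_obs V) rho)%:C)%C *: rho.
Proof.
move=> [hrho _ tr1]; apply: field_of_eq => [|a ha]; last first.
  by rewrite expectBr expectZr dual_map_kraus1 expect_dual_map_kraus.
have hV := herm_kraus_obs _ _ _ V.
split; first by apply: hermB; [exact: herm_kraus | exact: hermZ].
rewrite raddfB /= mxtraceZ tr1 mulr1 mxtrace_kraus mxtrace_mul_herm //.
by rewrite expectC subrr.
Qed.

Lemma ZLE (H : 'M[R[i]]_n) rho : herm H -> state rho ->
  ZL H V rho =
  ('i / 2%:R) *: comm H rho - jordan (kraus_obs V) rho + kraus V rho.
Proof.
move=> hH srho; have [hrho _ _] := srho.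
rewrite /ZL hamiltonian_fieldE // gradient_fieldE //; last exact: herm_kraus_obs.
(* The gradient and Kraus fields carry the same multiple of [rho]; the minus sign before the
   gradient field cancels them. *)
rewrite map_field_krausE // opprB [LHS]addrC [LHS]addrCA subrKA.
by rewrite [kraus _ _ - _]addrC addrA.
Qed.

Lemma ZL_lindblad (H : 'M[R[i]]_n) rho : herm H -> state rho ->
  ZL H V rho = lindblad ((- 2%:R^-1) *: H) V rho.
Proof.
move=> hH srho; rewrite ZLE // /lindblad.
have -> : comm (- 2%:R^-1 *: H) rho = - 2%:R^-1 *: comm H rho.
  by rewrite /comm -scalemxAl -scalemxAr -scalerBr.
have -> : \sum_(j < m) acomm (adj (V j) *m V j) rho = acomm (kraus_obs V) rho.
  by rewrite /acomm /kraus_obs mulmx_suml mulmx_sumr -big_split.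
(* Here (-i)(-1/2) = i/2; the other terms agree on unfolding [jordan] and [kraus]. *)
by rewrite scalerA mulrNN.
Qed.

Lemma act_ZL (H : 'M[R[i]]_n) a rho : herm H -> herm a -> state rho ->
  act (ZL H V) (expect a) rho =
  expect (lie H a) rho - expect (jordan (kraus_obs V) a) rho
  + expect (dual_map (kraus V) a) rho.
Proof.
move=> hH ha srho; have [hrho _ _] := srho.
rewrite /act dirder_expect ZLE // expectDr expectBr expect_lie expect_jordan.
by rewrite expect_dual_map_kraus.
Qed.

End Expectation.

(** * Tangency, linearity and the Lindblad equation *)

Theorem theorem4p4 (R : realType) (n : nat) (H : 'M[R[i]]_n)
    (V : 'I_(n ^ 2 - 1) -> 'M[R[i]]_n) (hH : herm H) :
  [/\ vector_field (ZL H V),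
      linear_field (ZL H V),
      forall a : 'M[R[i]]_n, herm a ->
        forall rho : 'M[R[i]]_n, state rho ->
          act (ZL H V) (expect a) rho =
          expect (lie H a) rho - expect (jordan (kraus_obs V) a) rho
          + expect (dual_map (kraus V) a) rho
    & forall (I : interval R) (rho : R -> 'M[R[i]]_n),
        (forall t : R, t \in I -> state (rho t)) ->
        (integral_curve (ZL H V) I rho <->
         solution (lindblad ((- 2%:R^-1) *: H) V) I rho)].
Proof.
have hV := herm_kraus_obs _ _ _ V.
split.
- move=> rho srho; have [hrho _ _] := srho; rewrite ZLE //; split.
    apply: hermD; last exact: herm_kraus.
    by apply: hermB; [exact: herm_comm_scaled | exact: herm_jordan].
  rewrite mxtraceD raddfB /= mxtrace_jordan mxtraceZ mxtrace_comm mulr0 sub0r.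
  by rewrite mxtrace_kraus addNr.
- move=> a ha.
  (* The witness is the dual of the generator applied to [a], read off from [act_ZL]. *)
  exists (lie H a - jordan (kraus_obs V) a + dual_map (kraus V) a).
    apply: hermD; first by apply: hermB; [exact: herm_lie | exact: herm_jordan].
    by rewrite dual_map_kraus //; exact: herm_kraus.
  move=> rho srho; rewrite act_ZL //.
  (* Symmetry of the pairing moves the observable into the argument where additivity is
     available. *)
  by rewrite ![expect _ rho]expectC expectDr expectBr.
- by move=> a ha rho srho; exact: act_ZL.
(* The two right-hand sides agree at states, and the curve stays among states on [I], so they can be
   exchanged at each time. *)
- move=> I rho srho; split.
    by move=> [_ sol] t tI; rewrite -ZL_lindblad; [exact: sol | | exact: srho].
  move=> sol; split=> // t tI.
  by rewrite ZL_lindblad; [exact: sol | | exact: srho].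
Qed.
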